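(* Let $0<p\le 1$ and let $(X,\|\cdot\|)$ be a $p$-normed space. Consider on $X$ the $p$-metric $\rho$ given by $\rho(x,y)=\|x-y\|$ and let $0$ be the distinguished point of $X$. Then $\widetilde\rho(x,y)=\|x-y\|_c$ for all $x,y\in X$.
   Context: A $p$-norm on a real vector space $X$ is a map $\|\cdot\|\colon X\to[0,\infty)$, vanishing only at $0$, with $\|\alpha x\|=|\alpha|\|x\|$ and $\|x+y\|^p\le\|x\|^p+\|y\|^p$ for all $x,y\in X$, $\alpha\in\mathbb R$. For $x,y\in X$, $\widetilde\rho(x,y)=\inf\sum_{i=0}^n\rho(x_i,x_{i+1})$, the infimum being over all finite sequences $x=x_0,x_1,\dots,x_{n+1}=y$ of points of $X$. $\|\cdot\|_c$ is the Banach envelope (semi)norm on $X$: the Minkowski functional $\|x\|_c=\inf\{\lambda>0\colon\lambda^{-1}x\in\mathrm{co}_1(B_X)\}$ of the smallest absolutely convex set $\mathrm{co}_1(B_X)$ containing the unit ball $B_X$ of $X$ (a set $\mathcal C$ is absolutely convex if $\lambda x+\mu y\in\mathcal C$ whenever $x,y\in\mathcal C$ and $|\lambda|+|\mu|\le1$). *)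

(* Defs.v *)
From mathcomp Require Import all_boot all_order all_algebra.
From mathcomp Require Import boolp classical_sets reals exp.

Set Implicit Arguments.
Unset Strict Implicit.
Unset Printing Implicit Defensive.

Import Order.TTheory GRing.Theory Num.Theory.
Local Open Scope classical_set_scope.
Local Open Scope ring_scope.

Record is_pnorm (R : realType) (X : lmodType R) (p : R) (nrm : X -> R) : Prop :=
  IsPnorm {
    pnorm_ge0 : forall x, 0 <= nrm x;
    pnorm_eq0 : forall x, nrm x = 0 -> x = 0;
    pnormZ : forall (a : R) x, nrm (a *: x) = `|a| * nrm x;
    pnorm_powD : forall x y, nrm (x + y) `^ p <= nrm x `^ p + nrm y `^ p
  }.

(* [rho] is a p-metric when [rho ^ p] is a metric. *)
Record is_pmetric (R : realType) (T : Type) (p : R) (rho : T -> T -> R) : Prop :=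
  IsPmetric {
    pmetric_ge0 : forall x y, 0 <= rho x y;
    pmetric_eq0 : forall x y, rho x y = 0 <-> x = y;
    pmetric_sym : forall x y, rho x y = rho y x;
    pmetric_triangle : forall x y z,
      rho x z `^ p <= rho x y `^ p + rho y z `^ p
  }.

Definition norm_dist (R : realType) (X : lmodType R) (nrm : X -> R) : X -> X -> R :=
  fun x y => nrm (x - y).

Lemma norm_dist_pmetric (R : realType) (X : lmodType R) (p : R) (nrm : X -> R) :
  is_pnorm p nrm -> is_pmetric p (norm_dist nrm).
Proof.
case=> ge0 eq0 nZ nD; split=> [x y|x y|x y|x y z]; rewrite /norm_dist //.
- split=> [/eq0/eqP|->]; first by rewrite subr_eq0 => /eqP.
  by rewrite subrr -(scale0r (0 : X)) nZ normr0 mul0r.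
- by rewrite -(opprB y x) -(scaleN1r (y - x)) nZ normrN normr1 mul1r.
- by have := nD (x - y) (y - z); rewrite addrA subrK.
Qed.

(* The sequence x_0, ..., x_(n+1) is the initial segment of [u : nat -> T]; the
   values of [u] beyond n+1 play no role.  The set is nonempty and, when [rho]
   is nonnegative, bounded below, so that [inf] is the actual infimum. *)
Definition chain_dist (R : realType) (T : Type) (rho : T -> T -> R) (x y : T) : R :=
  inf [set s | exists (n : nat) (u : nat -> T),
         [/\ u 0%N = x, u n.+1 = y & s = \sum_(i < n.+1) rho (u i) (u i.+1)]].

Definition absolutely_convex (R : realType) (X : lmodType R) (C : set X) : Prop :=
  forall (x y : X) (a b : R), C x -> C y -> `|a| + `|b| <= 1 ->
    C (a *: x + b *: y).

Definition absco (R : realType) (X : lmodType R) (A : set X) : set X :=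
  smallest (@absolutely_convex R X) A.

Definition minkowski_functional (R : realType) (X : lmodType R) (C : set X)
    (x : X) : R :=
  inf [set l : R | 0 < l /\ C (l^-1 *: x)].

Definition unit_ball (R : realType) (X : lmodType R) (nrm : X -> R) : set X :=
  [set x | nrm x <= 1].

(* When [nrm] is a p-norm the Minkowski functional is the infimum of a nonempty
   set: any l > 0 with [nrm x <= l] belongs to it. *)
Definition envelope_norm (R : realType) (X : lmodType R) (nrm : X -> R) : X -> R :=
  minkowski_functional (absco (unit_ball nrm)).

(* Main.v *)
Require Import Defs.
From mathcomp Require Import all_boot all_order all_algebra.
From mathcomp Require Import boolp classical_sets reals exp.
Import Order.TTheory GRing.Theory Num.Theory.
Local Open Scope ring_scope.

(** The increments of a chain from [x] to [y] form a finite decomposition of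
    [x - y] into vectors, and the length of the chain is the sum of their norms,
    the cost of the decomposition; conversely, the vectors obtained from [x] by
    subtracting the terms one by one form a chain.  Hence the chain distance
    is the infimum of the costs of decompositions of [x - y].

    On the other side, the absolutely convex hull of the unit ball consists
    exactly of the vectors having a decomposition of cost at most 1: such
    vectors form an absolutely convex set (concatenate scaled decompositions),
    and a vector decomposed as a sum of nonzero [v] is the combination of the
    unit vectors [v / nrm v] with coefficients [nrm v] ([absco_unit_ballE]).  By
    homogeneity the Minkowski functional of this hull is also the infimum of
    these costs.  The two infima range over different sets of numbers (exact
    costs, against positive upper bounds of costs), which have the same infimum
    ([chain_dist_le_cost] and [envelope_le_cost] give the two inequalities). *)

Section Decompositions.
Context {R : realType} {X : lmodType R} {nrm : X -> R}.
Hypothesis nrm_ge0 : forall x, 0 <= nrm x.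
Hypothesis nrm_eq0 : forall x, nrm x = 0 -> x = 0.
Hypothesis nrmZ : forall (a : R) x, nrm (a *: x) = `|a| * nrm x.

Definition total (s : seq X) : X := \sum_(v <- s) v.
Definition cost (s : seq X) : R := \sum_(v <- s) nrm v.

Lemma cost_ge0 s : 0 <= cost s.
Proof. by apply: sumr_ge0. Qed.

Lemma nrm0 : nrm 0 = 0.
Proof. by rewrite -(scale0r (0 : X)) nrmZ normr0 mul0r. Qed.

Lemma total_scale a s : total [seq a *: v | v <- s] = a *: total s.
Proof. by rewrite /total big_map scaler_sumr. Qed.

Lemma cost_scale a s : cost [seq a *: v | v <- s] = `|a| * cost s.
Proof.
by rewrite /cost big_map mulr_sumr; apply: eq_bigr => v _; rewrite nrmZ.
Qed.

(** The factor [cost s] is kept outside of [C], rather than divided out, so that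
    the induction also covers decompositions of cost 0. *)
Lemma total_in_cost_scale (C : set X) (s : seq X) :
  absolutely_convex C -> (unit_ball nrm `<=` C)%classic ->
  exists2 w, C w & total s = cost s *: w.
Proof.
move=> Cac BC; rewrite /total /cost.
have C0 : C 0 by apply: BC; rewrite /unit_ball /= nrm0 ler01.
elim: s => [|v s [w Cw sE]]; first by exists 0; rewrite // !big_nil scaler0.
rewrite !big_cons sE -/(cost s).
set a := nrm v; set b := cost s.
have a0 : 0 <= a by apply: nrm_ge0.
have b0 : 0 <= b by apply: cost_ge0.
have [v' Cv' vE] : exists2 v', C v' & v = a *: v'.
  have [/nrm_eq0 v0|an0] := eqVneq a 0; first by exists 0; rewrite // v0 scaler0.
  exists (a^-1 *: v); last by rewrite scalerA divff ?scale1r.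
  by apply: BC; rewrite /unit_ball /= nrmZ ger0_norm ?invr_ge0 // mulVf.
have [ab0|abn0] := eqVneq (a + b) 0.
  move/eqP: (ab0); rewrite paddr_eq0 // => /andP[/eqP az /eqP bz].
  by exists 0; rewrite // vE az bz !scale0r addr0 scaler0.
exists ((a / (a + b)) *: v' + (b / (a + b)) *: w).
  apply: Cac => //; rewrite !ger0_norm ?divr_ge0 ?addr_ge0 //.
  by rewrite -mulrDl divff.
by rewrite scalerDr !scalerA !(mulrC (a + b)) !divfK // -vE.
Qed.

Lemma absco_unit_ballE (z : X) :
  absco (unit_ball nrm) z <-> exists2 s, total s = z & cost s <= 1.
Proof.
split=> [Bz|[s <- s1] C [Cac BC]].
  apply: (Bz [set z | exists2 s, total s = z & cost s <= 1]%classic).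
  split=> [x y a b /= [s <- s1] [t <- t1] ab1|x /= x1].
    exists ([seq a *: v | v <- s] ++ [seq b *: v | v <- t]).
      by rewrite {1}/total big_cat -!/(total _) !total_scale.
    rewrite /cost big_cat -!/(cost _) /= !cost_scale.
    by apply: le_trans ab1; apply: lerD; apply: ler_piMr.
  by exists [:: x]; rewrite ?/total ?/cost big_seq1.
have [w Cw ->] := total_in_cost_scale C s Cac BC.
(* Adding [0 *: w] presents a scalar multiple as a combination of two points. *)
rewrite -[_ *: w]addr0 -(scale0r w); apply: Cac => //.
by rewrite normr0 addr0 ger0_norm ?cost_ge0.
Qed.

Lemma minkowski_memE (z : X) (l : R) : 0 < l ->
  absco (unit_ball nrm) (l^-1 *: z) <-> exists2 s, total s = z & cost s <= l.
Proof.
move=> l0; have ln0 := lt0r_neq0 l0.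
rewrite absco_unit_ballE; split=> -[s sE sl].
  exists [seq l *: v | v <- s].
    by rewrite total_scale sE scalerA divff // scale1r.
  by rewrite cost_scale gtr0_norm // ler_piMr // ltW.
exists [seq l^-1 *: v | v <- s]; first by rewrite total_scale sE.
by rewrite cost_scale gtr0_norm ?invr_gt0 // mulrC ler_pdivrMr ?mul1r.
Qed.

Lemma chain_of_decomposition (x y : X) (s : seq X) : total s = x - y ->
  exists (n : nat) (u : nat -> X), [/\ u 0%N = x, u n.+1 = y &
    cost s = \sum_(i < n.+1) norm_dist nrm (u i) (u i.+1)].
Proof.
move=> sE.
(* A chain has at least one step, so a null vector is put in front of [s]. *)
pose t := 0 :: s.
exists (size s), (fun i => y + total (drop i t)); split.
- by rewrite drop0 /total big_cons add0r -/(total s) sE addrC subrK.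
- by rewrite drop_oversize // /total big_nil addr0.
- have -> : cost s = cost t by rewrite /cost big_cons nrm0 add0r.
  rewrite /cost (big_nth 0) big_mkord; apply: eq_bigr => i _.
  rewrite /norm_dist (drop_nth 0) ?ltn_ord // {1}/total big_cons.
  by rewrite -/(total _) addrCA addrK.
Qed.

Lemma decomposition_of_chain (n : nat) (u : nat -> X) :
  exists2 s, total s = u 0%N - u n.+1 &
    cost s = \sum_(i < n.+1) norm_dist nrm (u i) (u i.+1).
Proof.
exists [seq u i - u i.+1 | i <- index_iota 0 n.+1].
  rewrite /total big_map -[RHS]opprB -(telescope_sumr u) // -sumrN.
  by apply: eq_bigr => i _; rewrite opprB.
by rewrite /cost big_map big_mkord.
Qed.

Lemma chain_dist_le_cost (x y : X) (s : seq X) : total s = x - y ->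
  chain_dist (norm_dist nrm) x y <= cost s.
Proof.
move=> sE; apply: ge_inf; last exact: chain_of_decomposition.
by exists 0 => _ [n [u [_ _ ->]]]; apply: sumr_ge0 => i _; apply: nrm_ge0.
Qed.

(** The cost itself may be 0, hence not admissible in the Minkowski functional,
    but every larger number is. *)
Lemma envelope_le_cost (s : seq X) : envelope_norm nrm (total s) <= cost s.
Proof.
apply/ler_addgt0Pr => e e0.
have le0 : 0 < cost s + e by apply: ltr_wpDl; rewrite ?cost_ge0.
apply: ge_inf; first by exists 0 => l [/ltW].
by split=> //; apply/minkowski_memE => //; exists s; rewrite // lerDl ltW.
Qed.

Lemma chain_dist_envelope (x y : X) :
  chain_dist (norm_dist nrm) x y = envelope_norm nrm (x - y).
Proof.
have one_term : total [:: x - y] = x - y by rewrite /total big_seq1.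
apply/eqP; rewrite eq_le; apply/andP; split; apply: lb_le_inf.
- have l0 : 0 < cost [:: x - y] + 1 by apply: ltr_wpDl; rewrite ?cost_ge0.
  exists (cost [:: x - y] + 1); split=> //; apply/minkowski_memE => //.
  by exists [:: x - y]; rewrite // lerDl.
- move=> l [l0 /(minkowski_memE _ _ l0) [s sE sl]].
  exact: le_trans (chain_dist_le_cost _ _ _ sE) sl.
- by exists (cost [:: x - y]); apply: chain_of_decomposition.
- move=> _ [n [u [<- <- ->]]].
  by have [s <- <-] := decomposition_of_chain n u; apply: envelope_le_cost.
Qed.

End Decompositions.

Theorem proposition3p7 (R : realType) (X : lmodType R) (p : R) (nrm : X -> R)
    (hp0 : 0 < p) (hp1 : p <= 1) (hnrm : is_pnorm p nrm) (x y : X) :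
  chain_dist (norm_dist nrm) x y = envelope_norm nrm (x - y).
Proof. by case: hnrm => ge0 eq0 nZ _; apply: chain_dist_envelope. Qed.
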